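(* For every polynomial $p$, $$\lim_{n\to\infty}n^2\bigl(F_n(p;x)-p(x)\bigr)=\frac{x(1-x)}2\,p''(x)-\frac{x(1-x)(1-2x)}6\,p'''(x),$$ uniformly for $x\in[0,1]$. In particular, $\lim_{n\to\infty}F_np=p$ for every polynomial $p$.
   Context: $\Pi_n$ is the space of polynomials of degree at most $n$. The Bernstein operator is $B_n(f;x)=\sum_{k=0}^n f(k/n)\binom nk x^k(1-x)^{n-k}$. The genuine Beta operator $\bar{\mathbb{B}}_n:C[0,1]\to C[0,1]$ is defined by $\bar{\mathbb{B}}_n(f;0)=f(0)$, $\bar{\mathbb{B}}_n(f;1)=f(1)$, and for $x\in(0,1)$ $$\bar{\mathbb{B}}_n(f;x)=\frac{1}{B(nx,n(1-x))}\int_0^1 t^{nx-1}(1-t)^{n(1-x)-1}f(t)\,dt,$$ where $B(\cdot,\cdot)$ is the Euler Beta function. $\bar{\mathbb{B}}_n$ restricts to a bijection $\Pi_n\to\Pi_n$, with inverse $\bar{\mathbb{B}}_n^{-1}$, and $F_n:=\bar{\mathbb{B}}_n^{-1}\circ B_n:C[0,1]\to\Pi_n$, $n\ge1$; $F_n(f;x)=(F_nf)(x)$. *)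

(* Defs.v *)
From HB Require Import structures.
From mathcomp Require Import all_boot all_order all_algebra.
From mathcomp Require Import all_classical all_reals all_analysis.

Set Implicit Arguments.
Unset Strict Implicit.
Unset Printing Implicit Defensive.

Import Order.TTheory GRing.Theory Num.Theory.
Import numFieldNormedType.Exports.

Local Open Scope classical_set_scope.
Local Open Scope ring_scope.

(* Elements of C[0,1] are represented by functions R -> R, of which only the
   values on [0,1] are used; the elements of Pi_n are the polynomials q with
   size q <= n.+1. *)

Definition bernstein (R : realType) (n : nat) (f : R -> R) : {poly R} :=
  \sum_(k < n.+1)
    (f (k%:R / n%:R) * 'C(n, k)%:R) *: ('X^k * (1 - 'X) ^+ (n - k)).

(* The open interval avoids the endpoint singularities, where the total
   function powR takes a conventional value; the endpoints are negligible. *)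
Definition euler_beta (R : realType) (a b : R) : R :=
  \int[lebesgue_measure]_(t in `]0, 1[)
    (t `^ (a - 1) * (1 - t) `^ (b - 1)).

(* Only meaningful for 1 <= n and x in [0,1]. *)
Definition genuine_beta (R : realType) (n : nat) (f : R -> R) (x : R) : R :=
  if x == 0 then f 0
  else if x == 1 then f 1
  else (euler_beta (n%:R * x) (n%:R * (1 - x)))^-1 *
    \int[lebesgue_measure]_(t in `]0, 1[)
      (t `^ (n%:R * x - 1) * (1 - t) `^ (n%:R * (1 - x) - 1) * f t).

(* The inverse of the bijection of Pi_n induced by genuine_beta n: the element
   of Pi_n that is mapped to g, the equality holding in C[0,1].  The default
   value 0 is never used when 1 <= n and size g <= n.+1. *)
Definition genuine_beta_inv (R : realType) (n : nat) (g : {poly R}) :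
    {poly R} :=
  xget 0 [set q : {poly R} | (size q <= n.+1)%N /\
    {in `[0, 1], genuine_beta n (horner q) =1 horner g}].

Definition F_op (R : realType) (n : nat) (f : R -> R) : {poly R} :=
  genuine_beta_inv n (bernstein n f).

(* Main.v *)
(** Put [phi = x (1 - x)].  On polynomials the Bernstein operator satisfies
    [B_n (x p) = (x + phi D / n) (B_n p)], while the recurrence
    [(a + b) B(a + 1, b) = a B(a, b)] shows that the inverse of the genuine
    Beta operator satisfies the same recurrence with [n] replaced by [- n].
    Hence [F_n = T_(-h) T_h] with [h = 1 / n], where [T_h] is the linear
    operator with [T_h 1 = 1] and [T_h (x p) = (x + h phi D) (T_h p)].  For a
    fixed polynomial, [T_h = 1 + h L1 + h^2 L2 + O(h^3)] with a remainder
    polynomial in [h], so that [F_n = 1 + h^2 (2 L2 - L1^2) + O(h^3)], where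
    [L1 = phi D^2 / 2] and
    [L2 = phi (1 - 2 x) D^3 / 6 + phi^2 D^4 / 8]. *)

Require Import Defs.
From HB Require Import structures.
From mathcomp Require Import all_boot all_order all_algebra.
From mathcomp Require Import all_classical all_reals all_analysis.
From mathcomp Require Import measurable_realfun ring lra.

Set Implicit Arguments.
Unset Strict Implicit.
Unset Printing Implicit Defensive.

Import Order.TTheory GRing.Theory Num.Theory.
Import numFieldNormedType.Exports.

Local Open Scope classical_set_scope.
Local Open Scope ring_scope.

(** * Polynomials determined by their values *)

Lemma eq_poly_itv01 (R : realFieldType) (p q : {poly R}) :
  {in `[0, 1], horner p =1 horner q} -> p = q.
Proof.
move=> pq; apply/eqP; rewrite -subr_eq0; apply/negPn/negP => pq0.
(* These are [size (p - q)] distinct points of the unit interval, one more than a nonzero [p - q]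
   can have as roots. *)
pose s := [seq (k.+1%:R : R)^-1 | k <- iota 0 (size (p - q))].
have := @max_poly_roots _ (p - q) s pq0.
rewrite size_map size_iota ltnn => /(_ _ _)/negP; apply => //.
  apply/allP => _ /mapP[k _ ->]; rewrite /root hornerD hornerN subr_eq0.
  apply/eqP/pq; rewrite in_itv/= invr_ge0 ler0n/=.
  by rewrite invf_le1 ?ltr0n// ler1n.
rewrite map_inj_uniq ?iota_uniq// => i j /invr_inj /eqP.
by rewrite eqr_nat => /eqP [].
Qed.

Lemma eq_poly_horner (R : realFieldType) (p q : {poly R}) :
  horner p =1 horner q -> p = q.
Proof. by move=> pq; apply: eq_poly_itv01 => x _. Qed.

(** * Linear maps prescribed on monomials *)

Section LinearExtension.
Variables (R : nzRingType) (V : lmodType R).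

Definition lin_ext (u : nat -> V) (p : {poly R}) : V :=
  \sum_(i < size p) p`_i *: u i.

Lemma lin_ext_widen (u : nat -> V) (p : {poly R}) n : (size p <= n)%N ->
  lin_ext u p = \sum_(i < n) p`_i *: u i.
Proof.
move=> pn; rewrite /lin_ext (big_ord_widen n (fun i => p`_i *: u i)) // big_mkcond.
by apply: eq_bigr => i _; case: ltnP => // ip; rewrite nth_default ?scale0r.
Qed.

Lemma lin_ext_is_linear u : linear (lin_ext u).
Proof.
move=> a p q; pose n := maxn (size (a *: p + q)) (maxn (size p) (size q)).
rewrite !(@lin_ext_widen _ _ n) ?leq_max ?leqnn ?orbT //.
rewrite scaler_sumr -big_split; apply: eq_bigr => i _ /=.
by rewrite coefD coefZ scalerDl scalerA.
Qed.

HB.instance Definition _ u :=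
  GRing.isLinear.Build R {poly R} V *:%R (lin_ext u) (lin_ext_is_linear u).

Lemma lin_extXn u k : lin_ext u 'X^k = u k.
Proof.
rewrite /lin_ext size_polyXn big_ord_recr /= coefXn eqxx scale1r big1 ?add0r //.
by move=> i _; rewrite coefXn ltn_eqF ?scale0r.
Qed.

(** Multiplication by ['X] shifts the sequence of images; this drives the induction that computes
    Beta integrals of polynomials. *)
Lemma lin_ext_MXaddC u (p : {poly R}) c :
  lin_ext u (p * 'X + c%:P) = lin_ext (fun k => u k.+1) p + c *: u 0%N.
Proof.
have sz : (size (p * 'X + c%:P)%R <= (size p).+1)%N.
  by rewrite size_MXaddC; case: ifP.
rewrite (@lin_ext_widen u _ _ sz) big_ord_recl addrC coefD coefMX coefC /= add0r.
congr (_ + _); apply: eq_bigr => i _.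
by rewrite coefD coefMX coefC /= addr0.
Qed.

Lemma eq_linear_Xn (f g : {linear {poly R} -> V}) :
  (forall k, f 'X^k = g 'X^k) -> f =1 g.
Proof.
move=> fg p; rewrite -[p]coefK poly_def !linear_sum; apply: eq_bigr => i _.
by rewrite !linearZ /= fg.
Qed.

End LinearExtension.

(** * The operator [T_h] and its expansion in powers of [h] *)

Section BernsteinAlgebra.
Variable R : realFieldType.
Implicit Types (h x : R) (p q : {poly R}).

Local Notation phi := ('X * (1 - 'X) : {poly R}).

Definition bern_step h q := 'X * q + h *: (phi * q^`()).

Lemma bern_step_is_linear h : linear (bern_step h).
Proof.
move=> a p q; rewrite /bern_step derivD derivZ !mulrDr -!scalerAr.
by rewrite !scalerDr !scalerA [h * a]mulrC addrACA.
Qed.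

HB.instance Definition _ h := GRing.isLinear.Build R {poly R} {poly R} *:%R
  (bern_step h) (bern_step_is_linear h).

(* [bern n^-1] is the Bernstein operator and [bern (- n^-1)] the inverse of the
   genuine Beta operator. *)
Definition bern h := lin_ext (fun k => iter k (bern_step h) 1).

HB.instance Definition _ h := GRing.Linear.on (bern h).

Lemma bernXn h k : bern h 'X^k = iter k (bern_step h) 1.
Proof. exact: lin_extXn. Qed.

Lemma bernC h c : bern h c%:P = c%:P.
Proof. by rewrite -alg_polyC linearZ /= (bernXn h 0). Qed.

Lemma bernD h p q : bern h (p + q) = bern h p + bern h q.
Proof. exact: linearD. Qed.

Lemma bernZ h a p : bern h (a *: p) = a *: bern h p.
Proof. exact: linearZ. Qed.

Lemma bern_mulX h p : bern h ('X * p) = bern_step h (bern h p).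
Proof.
rewrite -[p]coefK poly_def mulr_sumr 2!(linear_sum (bern h)).
rewrite (linear_sum (bern_step h)); apply: eq_bigr => i _.
by rewrite -scalerAr -exprS !linearZ /= !bernXn.
Qed.

(** The factor [phi] raises the degree by two and the derivative lowers it by one. *)
Lemma size_bern_step h q : (size (bern_step h q) <= (size q).+1)%N.
Proof.
have [->|q0] := eqVneq q 0; first by rewrite linear0 size_poly0.
apply: (leq_trans (size_polyD _ _)); rewrite geq_max; apply/andP; split.
  by rewrite mulrC size_mulX.
apply: (leq_trans (size_scale_leq _ _)); rewrite -mulrA mulrC.
have [->|q'0] := eqVneq ((1 - 'X) * q^`()) 0; first by rewrite mul0r size_poly0.
rewrite size_mulX // ltnS; apply: (leq_trans (size_polyMleq _ _)).
rewrite -opprB size_polyN size_XsubC /=.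
exact: lt_size_deriv.
Qed.

Lemma size_bern h p : (size (bern h p) <= size p)%N.
Proof.
apply: (leq_trans (size_sum _ _ _)); apply/bigmax_leqP => i _.
apply: (leq_trans (size_scale_leq _ _)); apply: leq_trans (ltn_ord i).
elim: (i : nat) => [|k IH]; first by rewrite size_poly1.
exact: leq_trans (size_bern_step _ _) _.
Qed.

(** [bern1] and [bern2] are [L1] and [L2], the coefficients of [h] and [h^2] in [bern h]. *)
Definition bern1 p := 2^-1 *: (phi * p^`(2)).
Definition bern2 p :=
  6^-1 *: (phi * (1 - 2 *: 'X) * p^`(3)) + 8^-1 *: (phi ^+ 2 * p^`(4)).

(** Here [Q] is a polynomial in [h] whose coefficients are polynomials in [x]. Differentiating each
    coefficient commutes with putting a constant for [h], so remainders stay polynomial in [h] under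
    [bern_step]. *)
Lemma horner_polyC_deriv (Q : {poly {poly R}}) : exists Q' : {poly {poly R}},
  forall h, Q'.[h%:P] = (Q.[h%:P])^`().
Proof.
elim/poly_ind: Q => [|Q c [Q' IH]].
  by exists 0 => h; rewrite !horner0 linear0.
exists (Q' * 'X + (c^`())%:P) => h.
by rewrite !hornerMXaddC IH derivD derivM derivC mulr0 addr0.
Qed.

Lemma bern_expansion p : exists Q : {poly {poly R}}, forall h,
  bern h p = p + h *: bern1 p + h ^+ 2 *: bern2 p + h ^+ 3 *: Q.[h%:P].
Proof.
elim/poly_ind: p => [|p c [Q IH]].
  exists 0 => h; rewrite linear0 /bern1 /bern2 !horner0.
  by rewrite !derivnS !derivn0 !linear0 !mulr0 !(scaler0, addr0).
have [Q' Q'E] := horner_polyC_deriv Q.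
(* ['X%:P] is the variable [x] and the outer ['X] is [h]. The first two summands are the step
   applied to the old remainder; the last is [h phi D] applied to [h^2 L2 p], divided by [h^3]. *)
exists (('X%:P) * Q + 'X * phi%:P * Q' + (phi * (bern2 p)^`())%:P) => h.
rewrite linearD /= bernC mulrC bern_mulX IH.
rewrite !hornerD !hornerM !hornerC hornerX Q'E.
move: (Q.[h%:P]) => q {Q Q' Q'E IH}.
apply: eq_poly_horner => x.
rewrite /bern_step /bern1 /bern2 !derivnS !derivn0.
do ![rewrite !(derivD, derivM, derivZ, derivC, derivX, derivN, exprS, expr0) /=].
rewrite !(hornerD, hornerM, hornerZ, hornerC, hornerX, hornerN, horner0).
by field.
Qed.

Lemma bern_opp_bern_expansion p : exists Q : {poly {poly R}}, forall h,
  bern (- h) (bern h p) = p + h ^+ 2 *: (2^-1 *: (phi * p^`(2))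
    - 6^-1 *: (phi * (1 - 2 *: 'X) * p^`(3))) + h ^+ 3 *: Q.[h%:P].
Proof.
have [Q0 E0] := bern_expansion p.
have [Q1 E1] := bern_expansion (bern1 p).
have [Q2 E2] := bern_expansion (bern2 p).
(* The remainder of the inner expansion depends on [h] itself, so [bern (- h)] is applied to its
   coefficients one by one, each being expanded in turn. *)
have bernQ (Q : {poly {poly R}}) : exists Q' : {poly {poly R}},
    forall h, bern (- h) Q.[h%:P] = Q'.[h%:P].
  elim/poly_ind: Q => [|Q c [Q' IH]].
    by exists 0 => h; rewrite !horner0 linear0.
  have [Qc Ec] := bern_expansion c.
  exists (Q' * 'X + (c%:P - 'X * (bern1 c)%:P + 'X ^+ 2 * (bern2 c)%:P
     - 'X ^+ 3 * (Qc \Po (- 'X)))) => h.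
  rewrite hornerMXaddC linearD /= [_ * h%:P]mulrC mul_polyC linearZ /= IH Ec.
  rewrite !(hornerD, hornerM, hornerN, hornerC, hornerX, horner_exp) horner_comp.
  rewrite !(hornerN, hornerX) -polyCN -!mul_polyC.
  by rewrite !rmorphXn /= !polyCN; ring.
have [Q3 E3] := bernQ Q0.
pose opp_arg (Q : {poly {poly R}}) := Q \Po (- 'X).
have oppE Q h : (opp_arg Q).[h%:P] = Q.[(- h)%:P].
  by rewrite horner_comp hornerN hornerX polyCN.
(* All terms of order three and more in the composed expansions, divided by [h^3]. The terms of
   order one cancel, and those of order two add up to [2 L2 - L1^2]. *)
exists (- opp_arg Q0 + (bern2 (bern1 p) - bern1 (bern2 p))%:P
  + 'X * ((bern2 (bern2 p))%:P - opp_arg Q1) - 'X ^+ 2 * opp_arg Q2 + Q3) => h.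
rewrite {1}E0 3!bernD (bernZ _ h) (bernZ _ (h ^+ 2)) (bernZ _ (h ^+ 3)).
rewrite E0 E1 E2 E3.
rewrite !(hornerD, hornerM, hornerN, hornerC, hornerX, horner_exp) !oppE.
move: (Q0.[_]) (Q1.[_]) (Q2.[_]) (Q3.[_]) => q0 q1 q2 q3 {E0 E1 E2 E3 oppE}.
(* The fourth derivatives in [L1^2] and [2 L2] cancel. Since [phi'' = -2], a second derivative of
   [p] appears, and [2 L2 - L1^2] is exactly the limit in the theorem. *)
have -> : bern1 (bern1 p) = 2 *: bern2 p - (2^-1 *: (phi * p^`(2))
    - 6^-1 *: (phi * (1 - 2 *: 'X) * p^`(3))).
  apply: eq_poly_horner => x; rewrite /bern1 /bern2 !derivnS !derivn0.
  do ![rewrite !(derivD, derivM, derivZ, derivC, derivX, derivN, exprS, expr0) /=].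
  rewrite !(hornerD, hornerM, hornerZ, hornerC, hornerX, hornerN, horner0).
  by field.
move: (bern2 (bern1 p)) (bern1 (bern2 p)) (bern2 (bern2 p)) => b21 b12 b22.
move: (bern1 p) (bern2 p) => b1 b2; apply: eq_poly_horner => x.
rewrite !(hornerD, hornerM, hornerZ, hornerC, hornerX, hornerN, horner_exp).
ring.
Qed.

End BernsteinAlgebra.

(** * The Bernstein operator and the polynomial form of the Beta operator in terms of [T_h] *)

Section Operators.
Variable R : realType.
Implicit Types (x : R) (p q : {poly R}).

Local Notation phi := ('X * (1 - 'X) : {poly R}).

Lemma mul_polyX_derivXn k : 'X * ('X^k)^`() = k%:R *: 'X^k :> {poly R}.
Proof.
rewrite derivXn; case: k => [|k]; first by rewrite mulr0n mulr0 scale0r.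
by rewrite scaler_nat mulrnAr -exprS.
Qed.

(** From [phi b' = (k (1 - x) - m x) b = (k - (k + m) x) b]: the Bernstein basis consists of
    eigenvectors of the step, and the eigenvalues are the nodes. *)
Lemma bern_step_basis k m : (0 < k + m)%N ->
  let b := 'X^k * (1 - 'X) ^+ m : {poly R} in
  bern_step (k + m)%:R^-1 b = (k%:R / (k + m)%:R) *: b.
Proof.
move=> km0 b.
have onemD : (1 - 'X) * ((1 - 'X : {poly R}) ^+ m)^`() = - m%:R *: (1 - 'X) ^+ m.
  rewrite deriv_exp derivB derivC derivX sub0r.
  case: m {b km0} => [|m]; first by rewrite mulr0n mulr0 oppr0 scale0r.
  by rewrite scaleNr scaler_nat exprS mulrnAr -mulNrn; congr (_ *+ _); ring.
have phiD : phi * b^`() = k%:R *: ((1 - 'X) * b) - m%:R *: ('X * b).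
  rewrite derivM -[phi * _](_ : (1 - 'X) * ('X * ('X^k)^`()) * (1 - 'X) ^+ m
      + 'X * 'X^k * ((1 - 'X) * ((1 - 'X) ^+ m)^`()) = _); last by ring.
  by rewrite mul_polyX_derivXn onemD /b -!mul_polyC polyCN; ring.
rewrite /bern_step phiD; apply: eq_poly_horner => x.
rewrite !(hornerD, hornerM, hornerZ, hornerC, hornerX, hornerN) natrD.
have : (k + m)%:R != 0 :> R by rewrite pnatr_eq0 -lt0n.
by rewrite natrD => ?; field.
Qed.

(** Passing from [p] to [x p] multiplies the value at the node [k / n] by [k / n], which is the
    eigenvalue of the matching basis polynomial. Constants are reproduced by the binomial formula
    for [((1 - x) + x)^n]. *)
Lemma bernstein_bern n p : (0 < n)%N ->
  bernstein n (horner p) = bern n%:R^-1 p.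
Proof.
move=> n0; elim/poly_ind: p => [|p c IH].
  by rewrite linear0 /bernstein big1 // => k _; rewrite horner0 mul0r scale0r.
rewrite bernD [in RHS]mulrC bern_mulX bernC -IH [LHS]/bernstein.
under eq_bigr do rewrite hornerMXaddC.
have -> : c%:P = \sum_(k < n.+1) (c * 'C(n, k)%:R) *: ('X^k * (1 - 'X) ^+ (n - k)).
  transitivity (c *: (((1 - 'X) + 'X) ^+ n : {poly R})).
    by rewrite subrK expr1n alg_polyC.
  rewrite exprDn scaler_sumr; apply: eq_bigr => k _.
  by rewrite -scalerA scaler_nat [in RHS]mulrC.
rewrite /bernstein (linear_sum (bern_step _)).
rewrite -big_split; apply: eq_bigr => k _ /=.
have kn : n = (k + (n - k))%N by rewrite subnKC // -ltnS.
rewrite linearZ /= [in bern_step _]kn bern_step_basis -?kn //.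
rewrite scalerA -scalerDl; congr (_ *: _); ring.
Qed.

(** The quotient of rising factorials [(n x)_k / (n)_k], that is, the moment of order [k] of the
    Beta distribution with parameters [n x] and [n (1 - x)]. *)
Definition beta_basis n k : {poly R} :=
  \prod_(j < k) ((n + j)%:R^-1 *: (n%:R *: 'X + j%:R%:P)).

Definition beta_poly n := lin_ext (beta_basis n).

HB.instance Definition _ n := GRing.Linear.on (beta_poly n).

Lemma beta_polyZ n a p : beta_poly n (a *: p) = a *: beta_poly n p.
Proof. exact: linearZ. Qed.

Lemma beta_polyXn n k : beta_poly n 'X^k = beta_basis n k.
Proof. exact: lin_extXn. Qed.

Lemma beta_basisS n k : beta_basis n k.+1 =
  (n + k)%:R^-1 *: (n%:R *: ('X * beta_basis n k) + k%:R *: beta_basis n k).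
Proof.
rewrite /beta_basis big_ord_recr /= -scalerAr mulrDr.
by rewrite -scalerAr [_ * 'X]mulrC [_ * _%:P]mulrC mul_polyC.
Qed.

(** The step with [h = - 1 / n] sends [x^k] to [x^(k+1) - (k / n) (1 - x) x^k]. Adding [k x^k] to
    [n] times this gives [(n + k) x^(k+1)], which undoes the recurrence of [beta_basis]. *)
Lemma bern_beta_poly n : (0 < n)%N ->
  cancel (beta_poly n) (bern (- n%:R^-1)).
Proof.
move=> n0 p; rewrite -[LHS]/((bern (- n%:R^-1) \o beta_poly n) p) -[RHS]/(idfun p).
move: p; apply: eq_linear_Xn => k /=; rewrite beta_polyXn.
elim: k => [|k IH]; first by rewrite /beta_basis big_ord0 expr0 bernC.
rewrite beta_basisS bernZ bernD 2!bernZ bern_mulX IH /bern_step.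
rewrite -mulrA mulrCA mul_polyX_derivXn; apply: eq_poly_horner => x.
rewrite !(hornerD, hornerM, hornerZ, hornerC, hornerX, hornerN, hornerXn).
rewrite natrD exprS.
have : n%:R != 0 :> R by rewrite pnatr_eq0 -lt0n.
have : n%:R + k%:R != 0 :> R by rewrite -natrD pnatr_eq0 addn_eq0 negb_and -lt0n n0.
by move=> ? ?; field; apply/andP.
Qed.

Lemma beta_poly_bern n : (0 < n)%N ->
  cancel (bern (- n%:R^-1)) (beta_poly n).
Proof.
move=> n0 p; rewrite -[LHS]/((beta_poly n \o bern (- n%:R^-1)) p) -[RHS]/(idfun p).
move: p; apply: eq_linear_Xn => k /=; rewrite bernXn.
(* [beta_poly n] turns the step into multiplication by ['X], hence sends its iterates at [1] back to
   the monomials. *)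
have stepE q : beta_poly n (bern_step (- n%:R^-1) q) = 'X * beta_poly n q.
  rewrite -[q]coefK poly_def (linear_sum (bern_step _)) 2!(linear_sum (beta_poly n)).
  rewrite mulr_sumr; apply: eq_bigr => i _.
  rewrite !linearZ -scalerAr /=; congr (_ *: _).
  rewrite /bern_step -mulrA mulrCA mul_polyX_derivXn -scalerAr mulrBl mul1r -exprS.
  rewrite (linearD (beta_poly n)) /= !beta_polyZ (linearB (beta_poly n)) /=.
  rewrite !beta_polyXn beta_basisS; apply: eq_poly_horner => x.
  rewrite !(hornerD, hornerM, hornerZ, hornerC, hornerX, hornerN) natrD.
  have : n%:R != 0 :> R by rewrite pnatr_eq0 -lt0n.
  have : n%:R + i%:R != 0 :> R.
    by rewrite -natrD pnatr_eq0 addn_eq0 negb_and -lt0n n0.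
  by move=> ? ?; field; apply/andP.
elim: k => [|k IH] /=; first by rewrite (beta_polyXn n 0) /beta_basis big_ord0.
by rewrite stepE IH exprS.
Qed.

End Operators.

(** * The fundamental theorem of calculus on the open unit interval, with possible singularities at
    the ends *)

Section IntegralDerivative.
Variable R : realType.
Local Notation mu := (@lebesgue_measure R).
Local Notation I01 := (`]0, 1[%classic : set R).

(** The offset 3 keeps [eps n] below [1/2], so that the interval [A n] is nondegenerate from [n = 0]
    on. *)
Let eps (n : nat) : R := n.+3%:R^-1.

Let eps_gt0 n : 0 < eps n.
Proof. by rewrite /eps invr_gt0. Qed.

Let eps_lt n : eps n < 1 - eps n.
Proof.
suff : eps n < 2^-1 by move=> ?; lra.
by rewrite /eps ltf_pV2 ?posrE // ltr_nat.
Qed.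

Let near_eps e : 0 < e -> \forall n \near \oo, eps n < e.
Proof.
move=> e0; have [N _ HN] := near_infty_natSinv_lt (PosNum e0).
exists N => // n /= Nn; apply: le_lt_trans (HN n Nn).
by rewrite /eps lef_pV2 ?posrE // ler_nat -addn2 leq_addr.
Qed.

Let eps_cvg0 : eps @ \oo --> 0.
Proof.
apply/cvgrPdist_lt => e e0; near=> n.
rewrite sub0r normrN gtr0_norm ?eps_gt0 //; near: n; exact: near_eps.
Unshelve. all: by end_near. Qed.

Let A n : set R := `[eps n, 1 - eps n]%classic.

Let nondecreasing_A : nondecreasing_seq A.
Proof.
move=> m n mn; rewrite subsetEset; apply: subset_itv; rewrite bnd_simp.
  by rewrite /eps lef_pV2 ?posrE // ler_nat.
by rewrite lerD2l lerN2 /eps lef_pV2 ?posrE // ler_nat.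
Qed.

Let A_sub n : A n `<=` I01.
Proof.
apply: subset_itv; rewrite bnd_simp; first exact: eps_gt0.
by have := eps_gt0 n; lra.
Qed.

Let near_A x : I01 x -> \forall n \near \oo, A n x.
Proof.
rewrite /= in_itv /= => /andP[x0 x1].
have m0 : 0 < Num.min x (1 - x) by rewrite lt_min x0 subr_gt0.
near=> n; rewrite /A /= in_itv /=.
have : eps n < Num.min x (1 - x) by near: n; exact: near_eps.
by rewrite lt_min => /andP[]; lra.
Unshelve. all: by end_near. Qed.

Let bigcup_A : \bigcup_n A n = I01.
Proof.
apply/seteqP; split => [x [n _]|x /near_A [n _ /(_ n (leqnn n)) Anx]].
  exact: A_sub.
by exists n.
Qed.

Section FTC.
Variables (f F : R -> R) (l0 l1 : R).
Hypotheses (dF : {in `]0, 1[, forall x : R, is_derive x 1 F (f x)})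
  (cf : {in `]0, 1[, continuous f})
  (F0 : F x @[x --> 0^'+] --> l0) (F1 : F x @[x --> 1^'-] --> l1).

Let measurable_f : measurable_fun I01 f.
Proof.
by apply: open_continuous_measurable_fun => // x /[!inE]; exact: cf.
Qed.

Let integral_A n :
  (\int[mu]_(x in A n) (f x)%:E = (F (1 - eps n))%:E - (F (eps n))%:E)%E.
Proof.
have sub x : x \in `[eps n, 1 - eps n] -> x \in `]0, 1[.
  exact: (@A_sub n x).
have cF : {within `[eps n, 1 - eps n], continuous F}.
  by apply: derivable_within_continuous => x /sub /dF [].
apply: continuous_FTC2; first exact: eps_lt.
- apply: continuous_in_subspaceT => x; rewrite inE => /sub; exact: cf.
- have [? ? ?] := (continuous_within_itvP _ (eps_lt n)).1 cF.
  by split => // x xA; case: (dF (sub x (subset_itv_oo_cc xA))).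
- move=> x xA; rewrite derive1E.
  by case: (dF (sub x (subset_itv_oo_cc xA))).
Qed.

Let cvg_integral_A :
  (\int[mu]_(x in A n) (f x)%:E)%E @[n --> \oo] --> (l1 - l0)%:E.
Proof.
under eq_fun do rewrite integral_A -EFinB.
apply: cvg_EFin; first exact: nearW.
apply: cvgB.
  apply: ((cvg_at_leftP F 1 l1).1 F1 (fun n => 1 - eps n)); split.
    by move=> n; have := eps_gt0 n; lra.
  by rewrite -[X in _ --> X]subr0; apply: cvgB => //; exact: cvg_cst.
by apply: ((cvg_at_rightP F 0 l0).1 F0 eps); split => // n; exact: eps_gt0.
Qed.

(** The integrals over the compact intervals [A n] tend to [l1 - l0]; monotone convergence makes
    this finite value the integral of [f]. *)
Lemma ge0_integrable_derivative_oo : {in `]0, 1[, forall x, 0 <= f x} ->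
  mu.-integrable I01 (EFin \o f).
Proof.
move=> f0; apply/integrableP; split; first exact/measurable_EFinP.
have -> : (\int[mu]_(x in I01) `|(EFin \o f) x| = (l1 - l0)%:E)%E; last exact: ltry.
rewrite -bigcup_A; under eq_integral.
  move=> x /[!inE] -[n _ /A_sub xI]; rewrite gee0_abs; last by rewrite lee_fin f0.
  over.
apply: cvg_unique cvg_integral_A => //.
apply: ge0_nondecreasing_set_cvg_integral => //.
- by move=> n; exact: measurable_itv.
- by move=> n; apply/measurable_EFinP; exact: measurable_funS measurable_f.
- by move=> n x /A_sub xI; rewrite lee_fin f0.
Qed.

(** Without a sign condition, dominated convergence with bound [|f|] takes the place of monotone
    convergence. *)
Lemma Rintegral_derivative_oo : mu.-integrable I01 (EFin \o f) ->
  \int[mu]_(x in I01) f x = l1 - l0.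
Proof.
move=> intf; rewrite /Rintegral -[RHS]/(fine (l1 - l0)%:E); congr fine.
apply: cvg_unique cvg_integral_A => //.
have -> : (fun n => \int[mu]_(x in A n) (f x)%:E)%E =
    (fun n => \int[mu]_(x in I01) ((EFin \o f) \_ (A n)) x)%E.
  by apply/funext => n; rewrite -integral_mkcondr (setIidr (@A_sub n)).
have [] // := @dominated_convergence _ _ _ mu I01 _ (fun n => (EFin \o f) \_ (A n))
   (EFin \o f) (abse \o (EFin \o f)).
- move=> n; apply/measurable_restrict => //; first exact: measurable_itv.
  by apply: (@measurable_funS _ _ _ _ I01) => //; exact/measurable_EFinP.
- exact/measurable_EFinP.
- apply: aeW => x Ix; apply: cvg_near_cst; near=> m; rewrite patchE mem_set //.
  by near: m; exact: near_A.
- exact: integrable_abse.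
- apply: aeW => x n Ix; rewrite patchE; case: ifP => //= _.
  by rewrite normr0 lee_fin normr_ge0.
Unshelve. all: by end_near. Qed.

End FTC.

End IntegralDerivative.

(** * Euler Beta integrals and their moments *)

Section BetaIntegral.
Variable R : realType.
Local Notation mu := (@lebesgue_measure R).
Local Notation I01 := (`]0, 1[%classic : set R).

Lemma cvg_at_left1_onem (g : R -> R) (l : R) :
  g x @[x --> 0^'+] --> l -> g (1 - x) @[x --> 1^'-] --> l.
Proof.
move=> /cvg_at_rightP gl; apply/cvg_at_leftP => u [u1 ul].
apply: (gl (fun n => 1 - u n)); split; first by move=> n; rewrite subr_gt0.
by rewrite -[X in _ --> X](subrr 1); apply: cvgB => //; exact: cvg_cst.
Qed.

Lemma cvg_at_right0_onem (g : R -> R) (l : R) :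
  g x @[x --> 1^'-] --> l -> g (1 - x) @[x --> 0^'+] --> l.
Proof.
move=> /cvg_at_leftP gl; apply/cvg_at_rightP => u [u1 ul].
apply: (gl (fun n => 1 - u n)); split; first by move=> n; rewrite ltrBlDr ltrDl.
by rewrite -[X in _ --> X]subr0; apply: cvgB => //; exact: cvg_cst.
Qed.

Lemma powR_continuous (a x : R) : 0 < x -> {for x, continuous (fun t : R => t `^ a)}.
Proof.
move=> x0; apply: differentiable_continuous; apply/derivable1_diffP.
by apply: derivable_powR; rewrite in_itv /= x0.
Qed.

Lemma powR_cvg_at_left1 (a : R) : t `^ a @[t --> 1^'-] --> (1 : R).
Proof.
apply: cvg_at_left_filter; have := @powR_continuous a 1 ltr01.
by rewrite /prop_for /continuous_at /= powR1.
Qed.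

Lemma is_derive_onem_powR (a x : R) : x < 1 ->
  is_derive x 1 (fun t => (1 - t) `^ a) (- (a * (1 - x) `^ (a - 1))).
Proof.
move=> x1; have x0 : 0 < 1 - x by rewrite subr_gt0.
have H : is_derive x 1 (fun t : R => 1 - t) (0 - 1).
  by apply: is_deriveB.
have := @is_derive1_comp _ (fun t : R => t `^ a) (fun t : R => 1 - t) x _ _
   (@is_derive1_powR R a _ x0) H.
by rewrite sub0r mulrN1.
Qed.

Lemma onem_powR_continuous (a x : R) : x < 1 ->
  {for x, continuous (fun t : R => (1 - t) `^ a)}.
Proof.
move=> x1; apply: differentiable_continuous; apply/derivable1_diffP.
by case: (is_derive_onem_powR a x1).
Qed.

Lemma integrable_powR_oo (a : R) : 0 < a ->
  mu.-integrable I01 (EFin \o (fun t => t `^ (a - 1))).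
Proof.
move=> a0; apply: (@ge0_integrable_derivative_oo R _
  (fun t => a^-1 * t `^ a) (a^-1 * 0) (a^-1 * 1)).
- move=> x; rewrite in_itv /= => /andP[x0 _].
  have := is_deriveZ a^-1 (@is_derive1_powR R a _ x0).
  by rewrite scalerA mulVf ?gt_eqF // scale1r.
- move=> x; rewrite in_itv /= => /andP[x0 _]; exact: powR_continuous.
- by apply: cvgM; [exact: cvg_cst|exact: powR_cvg0].
- by apply: cvgM; [exact: cvg_cst|exact: powR_cvg_at_left1].
- by move=> x _; exact: powR_ge0.
Qed.

Lemma integrable_onem_powR_oo (b : R) : 0 < b ->
  mu.-integrable I01 (EFin \o (fun t => (1 - t) `^ (b - 1))).
Proof.
move=> b0; apply: (@ge0_integrable_derivative_oo R _
  (fun t => - b^-1 * (1 - t) `^ b) (- b^-1 * 1) (- b^-1 * 0)).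
- move=> x; rewrite in_itv /= => /andP[_ x1].
  have := is_deriveZ (- b^-1) (is_derive_onem_powR b x1).
  by rewrite scalerN scaleNr opprK scalerA mulVf ?gt_eqF // scale1r.
- move=> x; rewrite in_itv /= => /andP[_ x1]; exact: onem_powR_continuous.
- apply: cvgM; first exact: cvg_cst.
  apply: (@cvg_at_right0_onem (fun t : R => t `^ b)); exact: powR_cvg_at_left1.
- apply: cvgM; first exact: cvg_cst.
  apply: (@cvg_at_left1_onem (fun t : R => t `^ b)); exact: powR_cvg0.
- by move=> x _; exact: powR_ge0.
Qed.

Definition beta_kernel (a b t : R) : R := t `^ (a - 1) * (1 - t) `^ (b - 1).

Lemma beta_kernelS a b t : 0 < a -> 0 <= t ->
  beta_kernel (a + 1) b t = t * beta_kernel a b t.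
Proof. by move=> a0 t0; rewrite /beta_kernel mulrA mulr_powRB1 // addrK. Qed.

Lemma beta_kernel_ge0 a b t : 0 <= beta_kernel a b t.
Proof. by rewrite mulr_ge0 ?powR_ge0. Qed.

Lemma powR_le1 (a t : R) : 0 <= a -> 0 < t -> t <= 1 -> t `^ a <= 1.
Proof. by move=> a0 t0 t1; rewrite -(powRr0 t); apply: ger_powR; rewrite ?t0. Qed.

Lemma integrable_beta_kernel a b : 0 < a -> 0 < b ->
  mu.-integrable I01 (EFin \o beta_kernel a b).
Proof.
move=> a0 b0.
have := integrableD _ (integrable_powR_oo a0) (integrable_onem_powR_oo b0).
move=> H; apply: (le_integrable _ _ _ (H _)) => // {H}.
  apply/measurable_EFinP; apply: measurable_funM.
    by apply/measurable_EFinP; exact: measurable_int (integrable_powR_oo a0).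
  by apply/measurable_EFinP; exact: measurable_int (integrable_onem_powR_oo b0).
move=> t; rewrite /= in_itv /= => /andP[t0 t1].
rewrite !ger0_norm ?beta_kernel_ge0 ?addr_ge0 ?powR_ge0 // lee_fin.
have s0 : 0 < 1 - t by rewrite subr_gt0.
(* Multiplying the kernel by [1 = (1 - t) + t] leaves in each summand at most one singular power,
   the other factor being at most 1. *)
have -> : beta_kernel a b t =
    (1 - t) `^ b * t `^ (a - 1) + t `^ a * (1 - t) `^ (b - 1).
  rewrite -(mulr_powRB1 (ltW t0) a0) -(mulr_powRB1 (ltW s0) b0) /beta_kernel; ring.
by apply: lerD; apply: ler_piMl; rewrite ?powR_ge0 ?powR_le1 //; lra.
Qed.

(** For a natural number [M] above [a - 1] and [b - 1], the kernel dominates [t^M (1 - t)^M] on []0,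
    1[], whose integral is the positive number [beta_fun M.+1 M.+1]. *)
Lemma euler_beta_gt0 (a b : R) : 0 < a -> 0 < b -> 0 < euler_beta a b.
Proof.
move=> a0 b0.
have [M aM bM] : exists2 M, a - 1 <= M%:R & b - 1 <= M%:R.
  exists (maxn (Num.bound `|a - 1|) (Num.bound `|b - 1|)).
    apply: (le_trans (ler_norm _)).
    apply/ltW/(lt_le_trans (archi_boundP (normr_ge0 _))).
    by rewrite ler_nat leq_maxl.
  apply: (le_trans (ler_norm _)).
  apply/ltW/(lt_le_trans (archi_boundP (normr_ge0 _))).
  by rewrite ler_nat leq_maxr.
have B0 : 0 < beta_fun M.+1 M.+1 :> R by exact: beta_fun_gt0.
apply: (lt_le_trans B0).
have intX := @integrable_XMonemX R M M.
have intX' : mu.-integrable I01 (EFin \o XMonemX M M).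
  by apply: integrableS intX => //; exact: subset_itv_oo_cc.
rewrite /beta_fun -Rintegral_mkcond /= -Rintegral_itv_bndo_bndc; last first.
  by apply: integrableS intX => //; exact: subset_itv_co_cc.
rewrite -Rintegral_itv_obnd_cbnd //.
apply: le_Rintegral => //; first exact: integrable_beta_kernel.
move=> t; rewrite /= in_itv /= => /andP[t0 t1].
have s0 : 0 < 1 - t by rewrite subr_gt0.
apply: ler_pM; rewrite ?exprn_ge0 ?(ltW t0) ?(ltW s0) //.
  by rewrite -powR_mulrn ?(ltW t0) //; apply: ger_powR; rewrite ?t0 ?(ltW t1).
rewrite -[X in X ^+ M]/(1 - t) -powR_mulrn ?(ltW s0) //; apply: ger_powR => //.
by rewrite s0 /= gerBl ltW.
Qed.

(** The function [t^a (1 - t)^b] tends to 0 at both ends, and its derivative is the [f] of the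
    proof, whose integral is therefore 0. *)
Lemma euler_betaS (a b : R) : 0 < a -> 0 < b ->
  euler_beta (a + 1) b = a / (a + b) * euler_beta a b.
Proof.
move=> a0 b0; have ab0 : 0 < a + b by rewrite addr_gt0.
have a10 : 0 < a + 1 by rewrite addr_gt0.
have ik := integrable_beta_kernel a0 b0.
have ik1 := integrable_beta_kernel a10 b0.
pose f t := a * beta_kernel a b t - (a + b) * beta_kernel (a + 1) b t.
have intf1 : mu.-integrable I01 (EFin \o (fun t => a * beta_kernel a b t)).
  exact: (@integrableZl _ _ _ mu I01 (measurable_itv _) a _ ik).
have intf2 :
    mu.-integrable I01 (EFin \o (fun t => (a + b) * beta_kernel (a + 1) b t)).
  exact: (@integrableZl _ _ _ mu I01 (measurable_itv _) (a + b) _ ik1).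
have intf : mu.-integrable I01 (EFin \o f).
  exact: (@integrableB _ _ _ mu I01 (measurable_itv _) _ _ intf1 intf2).
have := @Rintegral_derivative_oo R f (fun t => t `^ a * (1 - t) `^ b)
  (0 * 1) (1 * 0).
rewrite mulr0 mul0r subrr RintegralB // !RintegralZl // -/(euler_beta a b).
move=> H; have {H} : a * euler_beta a b - (a + b) * euler_beta (a + 1) b = 0.
  apply: H => //.
  - move=> x; rewrite in_itv /= => /andP[x0 x1].
    have s0 : 0 < 1 - x by rewrite subr_gt0.
    have := is_deriveM (@is_derive1_powR R a _ x0) (is_derive_onem_powR b x1).
    rewrite (_ : _ + _ = f x) // /f beta_kernelS ?(ltW x0) // /beta_kernel.
    rewrite -!(mulr_powRB1 (ltW x0) a0) -!(mulr_powRB1 (ltW s0) b0).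
    by rewrite -![_ *: _]/(_ * _); ring.
  - move=> x; rewrite in_itv /= => /andP[x0 x1].
    by apply: cvgB; (apply: cvgM; first exact: cvg_cst); apply: cvgM;
      do ?[exact: powR_continuous | exact: onem_powR_continuous].
  - rewrite -[X in _ --> X](mul0r 1); apply: cvgM; first exact: powR_cvg0.
    apply: (@cvg_at_right0_onem (fun t : R => t `^ b)); exact: powR_cvg_at_left1.
  - rewrite -[X in _ --> X](mulr0 1); apply: cvgM; first exact: powR_cvg_at_left1.
    apply: (@cvg_at_left1_onem (fun t : R => t `^ b)); exact: powR_cvg0.
move/eqP; rewrite subr_eq0 => /eqP H.
by rewrite mulrAC H mulrAC divff ?gt_eqF // mul1r.
Qed.

(** Induction on [q] for all [a] at once: a factor [t] is absorbed by the kernel, which passes from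
    [a] to [a + 1]. Integrability is carried along to split the integral of the sum. *)
Lemma beta_integral_horner (a b : R) (q : {poly R}) : 0 < a -> 0 < b ->
  mu.-integrable I01 (EFin \o (fun t => beta_kernel a b t * q.[t])) /\
  \int[mu]_(t in I01) (beta_kernel a b t * q.[t]) = euler_beta a b *
    lin_ext (fun k => \prod_(j < k) ((a + j%:R) / (a + b + j%:R)) : R^o) q.
Proof.
elim/poly_ind: q a b => [|q c IH] a b a0 b0.
  under eq_Rintegral do rewrite horner0 mulr0.
  split; last by rewrite Rintegral_cst // mul0r linear0 mulr0.
  apply: (eq_integrable _ (cst 0%E)) => //; last exact: integrable0.
  by move=> t _; rewrite /= horner0 mulr0.
have a10 : 0 < a + 1 by rewrite addr_gt0.
have [intq IHq] := IH (a + 1) b a10 b0.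
have intc : mu.-integrable I01 (EFin \o (fun t => c * beta_kernel a b t)).
  exact: (@integrableZl _ _ _ mu I01 (measurable_itv _) c _
    (integrable_beta_kernel a0 b0)).
have E : {in I01, (fun t => beta_kernel a b t * (q * 'X + c%:P).[t]) =1
    (fun t => beta_kernel (a + 1) b t * q.[t] + c * beta_kernel a b t)}.
  move=> t /[!inE] /=; rewrite in_itv /= => /andP[t0 _].
  by rewrite hornerMXaddC beta_kernelS ?(ltW t0) //; ring.
split.
  have := @integrableD _ _ _ mu I01 (measurable_itv _) _ _ intq intc.
  by apply: eq_integrable => // t tI; rewrite /= E.
transitivity (\int[mu]_(t in I01)
    (beta_kernel (a + 1) b t * q.[t] + c * beta_kernel a b t)).
  exact: eq_Rintegral.
rewrite RintegralD // IHq RintegralZl //; last exact: integrable_beta_kernel.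
rewrite -/(euler_beta a b) euler_betaS // lin_ext_MXaddC big_ord0.
(* The factor of index 0 is the ratio from [euler_betaS]; the remaining ones are the moments for
   [a + 1]. *)
have -> : lin_ext (fun k => \prod_(j < k.+1) ((a + j%:R) / (a + b + j%:R)) : R^o) q
   = a / (a + b) * lin_ext
      (fun k => \prod_(j < k) ((a + 1 + j%:R) / (a + 1 + b + j%:R)) : R^o) q.
  rewrite /lin_ext mulr_sumr; apply: eq_bigr => k _.
  rewrite big_ord_recl !addr0 -[_ *: _]/(_ * _) -[X in _ = _ * X]/(_ * _) mulrCA.
  congr (_ * (_ * _)); apply: eq_bigr => j _.
  rewrite -[lift _ _ : nat]/(j.+1) -natr1; congr (_ / _); ring.
rewrite -[c *: 1]/(c * 1); ring.
Qed.

End BetaIntegral.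

(** * The genuine Beta operator on polynomials and the formula for [F_n] *)

Section GenuineBeta.
Variable R : realType.
Implicit Types (x : R) (p q : {poly R}).

Lemma horner_lin_ext (u : nat -> {poly R}) q x :
  (lin_ext u q).[x] = lin_ext (fun k => (u k).[x] : R^o) q.
Proof.
by rewrite /lin_ext horner_sum; apply: eq_bigr => k _; rewrite hornerZ.
Qed.

Lemma horner_as_lin_ext q x : q.[x] = lin_ext (fun k => x ^+ k : R^o) q.
Proof. exact: horner_coef. Qed.

Lemma horner_beta_basis n k x :
  (beta_basis R n k).[x] = \prod_(j < k) ((n%:R * x + j%:R) / (n + j)%:R).
Proof.
rewrite /beta_basis horner_prod; apply: eq_bigr => j _.
by rewrite hornerZ hornerD hornerZ hornerX hornerC mulrC.
Qed.

(** In the interior this is the moment formula with [a + b = n], the positive normalising factor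
    cancelling. At [x = 0] and [x = 1] the rising factorial quotients reduce to [0^k] and 1. *)
Lemma genuine_beta_horner n q x : (0 < n)%N -> 0 <= x <= 1 ->
  genuine_beta n (horner q) x = (beta_poly n q).[x].
Proof.
move=> n0 /andP[x0 x1]; have n0R : 0 < n%:R :> R by rewrite ltr0n.
rewrite horner_lin_ext /genuine_beta; case: eqVneq => [->|xn0].
  rewrite horner_as_lin_ext; apply: eq_bigr => k _; congr (_ *: _).
  rewrite horner_beta_basis; case: (k : nat) => [|m]; first by rewrite big_ord0.
  by rewrite big_ord_recl mulr0 add0r mul0r mul0r expr0n.
case: eqVneq => [->|xn1].
  rewrite horner_as_lin_ext; apply: eq_bigr => k _; congr (_ *: _).
  rewrite horner_beta_basis expr1n big1 // => j _.
  by rewrite mulr1 -natrD divff // pnatr_eq0 addn_eq0 negb_and -lt0n n0.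
have a0 : 0 < n%:R * x by rewrite mulr_gt0 // lt_def xn0.
have b0 : 0 < n%:R * (1 - x) by rewrite mulr_gt0 // subr_gt0 lt_def eq_sym xn1.
have [_ ->] := beta_integral_horner q a0 b0.
rewrite mulrA mulVf ?mul1r ?gt_eqF ?euler_beta_gt0 //.
apply: eq_bigr => k _; congr (_ *: _); rewrite horner_beta_basis.
by apply: eq_bigr => j _; rewrite -mulrDr subrKC mulr1 natrD.
Qed.

Lemma size_bernstein n (f : R -> R) : (size (bernstein n f) <= n.+1)%N.
Proof.
apply: (leq_trans (size_sum _ _ _)); apply/bigmax_leqP => k _.
apply: (leq_trans (size_scale_leq _ _)); apply: (leq_trans (size_polyMleq _ _)).
rewrite size_polyXn addSn /=.
have -> : 1 - 'X = - ('X - 1%:P) :> {poly R} by rewrite opprB.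
rewrite exprNn -signr_odd mulr_sign; case: ifP; rewrite ?size_polyN.
all: by rewrite size_exp_XsubC addnS ltnS subnKC // -ltnS.
Qed.

Lemma F_op_horner n p : (0 < n)%N ->
  F_op n (horner p) = bern (- n%:R^-1) (bern n%:R^-1 p).
Proof.
move=> n0; rewrite /F_op /genuine_beta_inv bernstein_bern //.
have betaE q x : x \in `[0, 1] -> genuine_beta n (horner q) x = (beta_poly n q).[x].
  by rewrite in_itv /= => x01; exact: genuine_beta_horner.
apply: xget_unique => [|q [_ qE]] /=.
  split => [|x x01]; last by rewrite betaE // beta_poly_bern.
  (* The degree bound comes from the Bernstein polynomial, as [p] itself may have degree above
     [n]. *)
  apply: (leq_trans (size_bern _ _)); rewrite -bernstein_bern //.
  exact: size_bernstein.
(* Uniqueness: two preimages have the same image under [beta_poly n], which has a left inverse. *)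
rewrite -(bern_beta_poly n0 q); congr bern; apply: eq_poly_itv01 => x x01.
by rewrite -betaE // qE.
Qed.

End GenuineBeta.

(** * Uniform bounds and the passage to the limit *)

Section UniformConvergence.
Variable R : realType.
Implicit Types (x h : R) (p q : {poly R}).

Lemma poly_bounded01 p : exists C, forall x, 0 <= x <= 1 -> `|p.[x]| <= C.
Proof.
elim/poly_ind: p => [|p c [C IH]]; first by exists 0 => x _; rewrite horner0 normr0.
exists (C + `|c|) => x /[dup] /IH pC /andP[x0 x1]; rewrite hornerMXaddC.
apply: (le_trans (ler_normD _ _)); rewrite lerD2r normrM (ger0_norm x0).
exact: le_trans (ler_piMr (normr_ge0 _) x1) pC.
Qed.

Lemma poly2_bounded01 (Q : {poly {poly R}}) : exists C, forall h x,
  0 <= h <= 1 -> 0 <= x <= 1 -> `|Q.[h%:P].[x]| <= C.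
Proof.
elim/poly_ind: Q => [|Q c [C IH]].
  by exists 0 => h x _ _; rewrite !horner0 normr0.
have [D cD] := poly_bounded01 c.
exists (C + D) => h x h01 x01; have /andP[h0 h1] := h01.
rewrite hornerMXaddC hornerD hornerM hornerC.
apply: (le_trans (ler_normD _ _)); apply: lerD; last exact: cD.
rewrite normrM (ger0_norm h0).
exact: le_trans (ler_piMr (normr_ge0 _) h1) (IH _ _ h01 x01).
Qed.

(** Every entourage of the reals contains the pairs at distance below some [e], and [C / n < e] once
    [n > C / e]. *)
Lemma cvg_uniform_rate (A : set R) (g : nat -> R -> R) (f : R -> R) (C : R) :
  (forall n x, (0 < n)%N -> A x -> `|g n x - f x| <= C / n%:R) ->
  {uniform A, g @ \oo --> f}.
Proof.
move=> gf P /uniform_nbhs[E [/= entE subP]]; change (\forall n \near \oo, P (g n)).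
have [e e0 ballE] : exists2 e : R, 0 < e & forall u v, `|u - v| < e -> E (u, v).
  move: entE; rewrite -entourage_ballE => -[e /= e0 sub].
  by exists e => // u v uv; apply: sub.
near=> n; apply: subP => x Ax; apply: ballE; rewrite distrC.
have n0 : (0 < n)%N by near: n; exact: nbhs_infty_gt.
apply: (le_lt_trans (gf n x n0 Ax)).
rewrite ltr_pdivrMr ?ltr0n // mulrC -ltr_pdivrMr //.
by near: n; exact: nbhs_infty_gtr.
Unshelve. all: by end_near. Qed.

End UniformConvergence.

Theorem mainTheorem7 (R : realType) (p : {poly R}) :
  {uniform `[0, 1], (fun (n : nat) (x : R) =>
      n%:R ^+ 2 * ((F_op n (horner p)).[x] - p.[x])) @ \oo -->
    (fun x : R => x * (1 - x) / 2 * (p^`(2)).[x]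
                  - x * (1 - x) * (1 - 2 * x) / 6 * (p^`(3)).[x])} /\
  {uniform `[0, 1], (fun (n : nat) (x : R) => (F_op n (horner p)).[x]) @ \oo
    --> horner p}.
Proof.
have [Q FQ] := bern_opp_bern_expansion p.
set G : {poly R} := _ - _ in FQ.
have GE x : G.[x] = x * (1 - x) / 2 * (p^`(2)).[x]
    - x * (1 - x) * (1 - 2 * x) / 6 * (p^`(3)).[x].
  rewrite /G !(hornerD, hornerM, hornerZ, hornerC, hornerX, hornerN).
  by ring.
clearbody G; have [C QC] := poly2_bounded01 Q; have [D GD] := poly_bounded01 G.
have FE n x : (0 < n)%N ->
    (F_op n (horner p)).[x] - p.[x] =
      n%:R^-1 ^+ 2 * G.[x] + n%:R^-1 ^+ 3 * Q.[n%:R^-1%:P].[x].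
  by move=> n0; rewrite F_op_horner // FQ !hornerD !hornerZ; ring.
have n01 n : (0 < n)%N -> 0 <= (n%:R^-1 : R) <= 1.
  by move=> n0; rewrite invr_ge0 ler0n /= invf_le1 ?ltr0n // ler1n.
split.
- apply: (@cvg_uniform_rate _ _ _ _ C) => n x n0; rewrite /= in_itv /= => x01.
  have nn0 : n%:R != 0 :> R by rewrite pnatr_eq0 -lt0n.
  rewrite -GE FE // (_ : _ - _ = Q.[n%:R^-1%:P].[x] / n%:R); last by field.
  have /andP[i0 _] := n01 n n0.
  by rewrite normrM (ger0_norm i0) ler_wpM2r // QC ?n01.
(* Since [1 / n] is at most 1, its square and cube are at most [1 / n]; thus [D] bounds the
   contribution of [G] and [C] that of the remainder. *)
- apply: (@cvg_uniform_rate _ _ _ _ (D + C)) => n x n0; rewrite /= in_itv /= => x01.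
  have /andP[i0 i1] := n01 n n0; rewrite FE // mulrDl.
  apply: (le_trans (ler_normD _ _)); rewrite (normrM _ G.[x]) (normrM _ Q.[_].[x]).
  rewrite !(ger0_norm (exprn_ge0 _ i0)).
  have Gx := GD x x01; have Qx := QC _ x (n01 n n0) x01.
  apply: lerD; rewrite mulrC; apply: ler_pM; rewrite ?exprn_ge0 //.
    by rewrite exprS ler_piMr // expr1.
  by rewrite exprS ler_piMr // exprn_ile1.
Qed.
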